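(* There do not exist absolute constants $C, c > 0$ such that every graph $G$ contains an induced subgraph $G'$ with $\chi(G') \geq c\cdot\chi(G)$ and $\alpha(G') \leq C\,\frac{|V(G')|}{\chi(G')}$. Moreover, for any constants $C, c>0$ and all sufficiently large $k$ (depending on $C$ and $c$), the Kneser graph $G = KG_{3k,k}$ contains no such induced subgraph $G'$.
   Context: Graphs are finite, simple and have at least one vertex; $\chi$ denotes the chromatic number and $\alpha$ the independence number (the maximum size of a set of vertices containing no edges). For $n\ge k\ge 0$, the Kneser graph $KG_{n,k}$ is the graph whose vertices are the $k$-element subsets of $\{1,\dots,n\}$, two vertices being adjacent iff the corresponding sets are disjoint. *)

(* Defs.v *)
From HB Require Import structures.
From mathcomp Require Import all_boot all_order all_algebra.
From mathcomp Require Import reals.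

Set Implicit Arguments.
Unset Strict Implicit.
Unset Printing Implicit Defensive.

Import Order.TTheory GRing.Theory Num.Theory.

(* Having at least one vertex is not part of the record: it is a separate
   hypothesis wherever a graph or an induced subgraph is quantified over. *)
Record sgraph := SGraph {
  svertex :> finType;
  sedge : rel svertex;
  sedge_sym : symmetric sedge;
  sedge_irr : irreflexive sedge
}.

Section Invariants.
Variable G : sgraph.

Definition proper_coloring (q : nat) (f : {ffun G -> 'I_q}) : bool :=
  [forall x, forall y, sedge x y ==> (f x != f y)].

Definition colorable (q : nat) : bool :=
  [exists f : {ffun G -> 'I_q}, proper_coloring f].

Lemma colorable_card : exists q, colorable q.
Proof.
exists #|G|; apply/existsP; exists [ffun x => enum_rank x].
apply/forallP=> x; apply/forallP=> y; apply/implyP=> xy; rewrite !ffunE.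
by apply/eqP=> /enum_rank_inj eq_xy; rewrite eq_xy sedge_irr in xy.
Qed.

Definition chi : nat := ex_minn colorable_card.

Definition independent (S : {set G}) : bool :=
  [forall x in S, forall y in S, ~~ sedge x y].

Definition alpha : nat := \max_(S : {set G} | independent S) #|S|.

End Invariants.

Section Induced.
Variables (G : sgraph) (S : {set G}).

Definition induced_edge : rel {x : G | x \in S} :=
  fun x y => sedge (val x) (val y).

Fact induced_sym : symmetric induced_edge.
Proof. by move=> x y; apply: sedge_sym. Qed.

Fact induced_irr : irreflexive induced_edge.
Proof. by move=> x; apply: sedge_irr. Qed.

Definition induced : sgraph := SGraph induced_sym induced_irr.

End Induced.

Section Kneser.
Variables n k : nat.

(* The clause A != B only matters for k = 0, where the unique vertex set0 is
   disjoint from itself and would otherwise carry a loop. *)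
Definition kneser_edge : rel {A : {set 'I_n} | #|A| == k} :=
  fun A B => (A != B) && [disjoint val A & val B].

Fact kneser_sym : symmetric kneser_edge.
Proof. by move=> A B; rewrite /kneser_edge eq_sym disjoint_sym. Qed.

Fact kneser_irr : irreflexive kneser_edge.
Proof. by move=> A; rewrite /kneser_edge eqxx. Qed.

Definition kneser : sgraph := SGraph kneser_sym kneser_irr.

End Kneser.

Definition has_good_induced (R : realType) (C c : R) (G : sgraph) : Prop :=
  exists S : {set G},
    let G' := induced S in
    [/\ (0 < #|G'|)%N,
        (c * (chi G)%:R <= (chi G')%:R)%R &
        ((alpha G')%:R <= C * (#|G'|%:R / (chi G')%:R))%R].

(* Main.v *)
Require Import Defs.
From HB Require Import structures.
From mathcomp Require Import all_boot all_order all_algebra.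
From mathcomp Require Import reals.
From mathcomp Require Import zify.
Import Order.TTheory GRing.Theory Num.Theory.

(** In a family [S] of [k]-subsets of a [3k]-set, some point lies in at least a
    third of the members; its star is independent, so
    [|S| / 3 <= alpha <= C |S| / chi(S)], that is [chi(S) <= 3 C]. It remains to
    see that [chi(KG_{3k,k})] is unbounded. For a [q]-colouring, let [D_i] be
    the family of sets containing no [k]-set of colour [i]. It is closed under
    subsets and contains [B] or its complement for every [B], hence at least
    half of all sets. By the Harris-Kleitman inequality the [D_i] have at least
    [2^(n-q)] members in common, but these are just the sets of size less than
    [k], of which there are exponentially fewer than [2^n] when [n = 3k]. *)

(** * The Harris-Kleitman inequality for downsets *)

Section HarrisKleitman.
Variable T : finType.
Implicit Types (A B X : {set T}) (D E : {set {set T}}).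

Definition downset D := forall A B, A \subset B -> B \in D -> A \in D.

Definition link D x := [set B | x |: B \in D].

Lemma link_downset D x : downset D -> downset (link D x).
Proof.
by move=> dD A B sAB; rewrite !inE; apply: dD; apply: setUS.
Qed.

(** Split by whether a member contains [x]; deleting [x] from those that do gives the trace of the
    link. *)
Lemma card_trace_link D x X : x \notin X ->
  #|D :&: powerset (x |: X)| =
  #|D :&: powerset X| + #|link D x :&: powerset X|.
Proof.
move=> xX; rewrite -(cardsID [set B : {set T} | x \notin B] (D :&: _)); congr (_ + _).
  apply: eq_card => B; rewrite !inE -andbA; congr (_ && _).
  by rewrite -subsetD1 setU1K.
rewrite -(@card_in_imset _ _ (setU [set x]) (link D x :&: _)); last first.
  move=> A B; rewrite !inE => /andP[_ sA] /andP[_ sB] eqAB.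
  have xA : x \notin A by apply: contra xX; apply: subsetP.
  have xB : x \notin B by apply: contra xX; apply: subsetP.
  by rewrite -(setU1K xA) -(setU1K xB) eqAB.
apply: eq_card => B; apply/idP/imsetP.
  rewrite !inE negbK => /and3P[xB BD sB].
  by exists (B :\ x); rewrite ?inE ?setD1K // BD subDset.
move=> [A]; rewrite !inE negbK => /andP[AD sA] ->.
by rewrite setU11 AD setUS.
Qed.

(** Only subsets of [X] are counted, so that the induction can delete a point while [T] stays
    fixed. *)
Lemma harris_kleitman_trace D E X : downset D -> downset E ->
  #|D :&: powerset X| * #|E :&: powerset X| <=
  2 ^ #|X| * #|D :&: E :&: powerset X|.
Proof.
have [m] := ubnP #|X|; elim: m X D E => // m IHm X D E leXm dD dE.
have [->|[x xX]] := set_0Vmem X.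
  rewrite powerset0 cards0 expn0 mul1n.
  have cardI1 (F : {set {set T}}) : #|F :&: [set set0]| = (set0 \in F).
    have [F0|F0] := boolP (set0 \in F).
      by rewrite (setIidPr _) ?cards1 // sub1set.
    by apply/eqP; rewrite cards_eq0 setI_eq0 disjoint_sym disjoints1.
  by rewrite !cardI1 inE mulnb.
have xX' : x \notin X :\ x by rewrite !inE eqxx.
rewrite -(setD1K xX) !card_trace_link // cardsU1 xX'.
move: leXm; rewrite (cardsD1 x) xX ltnS => leXm.
have sub_link F : downset F ->
    #|link F x :&: powerset (X :\ x)| <= #|F :&: powerset (X :\ x)|.
  move=> dF; apply/subset_leq_card/setSI/subsetP => B.
  by rewrite inE; apply: dF; apply: subsetUr.
have := IHm _ D E leXm dD dE.
have := IHm _ _ _ leXm (link_downset D x dD) (link_downset E x dE).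
have -> : link D x :&: link E x = link (D :&: E) x.
  by apply/setP=> B; rewrite !inE.
rewrite add1n expnS -mulnA.
(* Link traces are the smaller ones, [a' <= a] and [b' <= b], so [(a - a') * (b - b') >= 0], that
   is, [(a + a') * (b + b') <= 2 * (a * b + a' * b')]. *)
have := sub_link D dD; have := sub_link E dE.
move: #|_| #|_| #|_| #|_| #|_| #|_| (2 ^ _).
nia.
Qed.

Lemma harris_kleitman D E : downset D -> downset E ->
  #|D| * #|E| <= 2 ^ #|T| * #|D :&: E|.
Proof.
move=> dD dE; have := harris_kleitman_trace D E setT dD dE.
by rewrite powersetT !setIT cardsT.
Qed.

Lemma card_half_family D : (forall B, (B \in D) || (~: B \in D)) ->
  2 ^ #|T| <= 2 * #|D|.
Proof.
move=> cD; rewrite -cardsT -card_powerset powersetT mul2n -addnn.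
rewrite -{2}(card_imset D (can_inj (@setCK T))).
apply: leq_trans (leq_card_setU _ _); apply/subset_leq_card/subsetP => B _.
rewrite inE; have /orP[->//|CBD] := cD B.
by apply/orP; right; apply/imsetP; exists (~: B); rewrite ?setCK.
Qed.

(** Intersections of downsets are downsets, so Harris-Kleitman applies repeatedly, each new family
    costing a factor 2. *)
Lemma card_inter_half_downsets (I : eqType) (r : seq I) (D : I -> {set {set T}}) :
  (forall i, downset (D i)) -> (forall i, 2 ^ #|T| <= 2 * #|D i|) ->
  2 ^ #|T| <= 2 ^ size r * #|[set B | all (fun i => B \in D i) r]|.
Proof.
move=> dD halfD; elim: r => [|i r IHr] /=.
  rewrite expn0 mul1n -cardsT -card_powerset powersetT.
  by apply/subset_leq_card/subsetP=> B; rewrite !inE.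
set E := [set B | all _ r] in IHr.
have dE : downset E.
  move=> A B sAB; rewrite !inE => /allP BD; apply/allP=> j rj.
  exact: dD sAB (BD j rj).
have -> : [set B | (B \in D i) && all (fun i => B \in D i) r] = D i :&: E.
  by apply/setP=> B; rewrite !inE.
rewrite -(@leq_pmul2l (2 ^ #|T|)) ?expn_gt0 //.
apply: leq_trans (leq_mul (halfD i) IHr) _.
by rewrite mulnACA -expnS [leqRHS]mulnCA leq_mul2l harris_kleitman ?orbT.
Qed.

End HarrisKleitman.

(** * The chromatic number of Kneser graphs *)

Lemma card_small_sets (n k : nat) :
  #|[set B : {set 'I_n} | #|B| < k]| = \sum_(j < k) 'C(n, j).
Proof.
elim: k => [|k IHk].
  by rewrite big_ord0; apply: eq_card0 => B; rewrite inE.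
rewrite big_ord_recr /= -IHk -[in 'C(n, k)](card_ord n) -card_draws.
rewrite -cardsUI [X in _ + X]eq_card0 ?addn0 => [|B]; last first.
  by rewrite !inE; case: ltngtP.
by apply: eq_card => B; rewrite !inE ltnS leq_eqVlt orbC.
Qed.

Lemma kneser_coloring_bound (n k q : nat) :
  0 < k -> colorable (kneser n k) q -> 2 ^ n <= 2 ^ q * \sum_(j < k) 'C(n, j).
Proof.
move=> k0 /existsP[f /forallP f_proper].
pose D (i : 'I_q) : {set {set 'I_n}} :=
  [set B : {set 'I_n} | [forall A : kneser n k, (val A \subset B) ==> (f A != i)]].
have dD i : downset _ (D i).
  move=> A B sAB; rewrite !inE => /forallP BD; apply/forallP=> F.
  apply/implyP=> sFA; have /implyP := BD F; apply; exact: subset_trans sFA sAB.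
have halfD i : 2 ^ #|'I_n| <= 2 * #|D i|.
  (* Otherwise [B] and its complement would each contain a [k]-set of colour [i], and these two are
     adjacent. *)
  apply: card_half_family => B; apply/norP; rewrite !inE.
  rewrite !negb_forall => -[/existsP[A]] + /existsP[A'].
  rewrite !negb_imply => /and3P[sA /eqP fA _] /and3P[sA' /eqP fA' _].
  have /forallP/(_ A')/implyP := f_proper A; rewrite fA fA' eqxx.
  have disjAA' : [disjoint val A & val A'].
    by apply: disjointWl sA _; rewrite disjoint_sym disjoints_subset.
  rewrite /sedge /= /kneser_edge disjAA' andbT => contraAA'.
  suff /contraAA' : A != A' by [].
  apply: contraTneq disjAA' => ->; rewrite -setI_eq0 setIid -cards_eq0.
  by rewrite (eqP (valP A')) -lt0n.
have := card_inter_half_downsets _ _ (enum 'I_q) D dD halfD.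
rewrite size_enum_ord card_ord -card_small_sets => /leq_trans; apply.
rewrite leq_mul2l; apply/orP; right.
apply/subset_leq_card/subsetP => B; rewrite !inE => /allP BD.
(* A set [B] with at least [k] elements contains a [k]-set, whose colour [i] excludes [B] from
   [D i]. *)
rewrite ltnNge; apply/negP => /card_geqP[s [us ss sB]].
have cA : #|[set x in s]| == k by rewrite cardsE (card_uniqP us) ss.
have := BD (f (Sub [set x in s] cA)) (mem_enum _ _).
rewrite inE => /forallP/(_ (Sub [set x in s] cA)); rewrite eqxx implybF.
by case/negP; apply/subsetP => x; rewrite inE; apply: sB.
Qed.

(* Chernoff bound: weight a set of size [j] by [2^(3k-j)], which is at least
   [4^k] for [j <= k]; the total weight is [3^(3k)]. *)
Lemma sum_bin_third (k : nat) : 4 ^ k * \sum_(j < k) 'C(3 * k, j) <= 27 ^ k.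
Proof.
have -> : 27 ^ k = (2 + 1) ^ (3 * k) by rewrite expnM.
rewrite expnDn big_distrr /=.
rewrite (big_ord_widen (3 * k).+1 (fun j => 4 ^ k * 'C(3 * k, j))); last lia.
rewrite [leqRHS](bigID (fun j : 'I__ => j < k)) /=.
apply: leq_trans (leq_addr _ _); apply: leq_sum => j jk.
have -> : 4 ^ k = 2 ^ (2 * k) by rewrite expnM.
rewrite exp1n muln1 mulnC leq_mul2l leq_exp2l //.
apply/orP; right; lia.
Qed.

Lemma colorable_chi (G : sgraph) : colorable G (chi G).
Proof. by rewrite /chi; case: ex_minnP. Qed.

Lemma chi_gt0 (G : sgraph) : 0 < #|G| -> 0 < chi G.
Proof.
move=> /card_gt0P[x _]; have /existsP[f _] := colorable_chi G.
by case: (chi G) f => // f; case: (f x).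
Qed.

Lemma chi_kneser_third (k : nat) : 0 < k ->
  32 ^ k <= 2 ^ chi (kneser (3 * k) k) * 27 ^ k.
Proof.
move=> k0; have -> : 32 ^ k = 4 ^ k * 2 ^ (3 * k) by rewrite expnM -expnMn.
have := kneser_coloring_bound (3 * k) k _ k0 (colorable_chi _).
rewrite -(@leq_pmul2l (4 ^ k)) ?expn_gt0 // => /leq_trans; apply.
by rewrite mulnCA leq_mul2l sum_bin_third orbT.
Qed.

Lemma bernoulli27 (k : nat) : 27 ^ k * k <= 6 * 32 ^ k.
Proof.
(* Bernoulli's [(1 + 5/27)^k >= 1 + 5k/27] with denominators cleared; then [27/5 <= 6]. *)
have : 27 ^ k * (27 + 5 * k) <= 27 * 32 ^ k.
  by elim: k => [|k IHk]; rewrite ?expn0 // !expnS; nia.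
nia.
Qed.

Lemma chi_kneser_third_unbounded (q : nat) :
  exists k0, forall k, k0 <= k -> q < chi (kneser (3 * k) k).
Proof.
(* If [chi <= q], the bounds give [27 ^ k * k <= 6 * 2 ^ q * 27 ^ k], hence [k <= 6 * 2 ^ q]. *)
exists (6 * 2 ^ q).+1 => k ltqk; rewrite ltnNge; apply/negP => le_chi_q.
have := chi_kneser_third k (leq_ltn_trans (leq0n _) ltqk).
have : 2 ^ chi (kneser (3 * k) k) <= 2 ^ q by rewrite leq_exp2l.
have := bernoulli27 k; have : 0 < 27 ^ k by rewrite expn_gt0.
nia.
Qed.

(** * Stars and the independence number *)

Lemma sum_card_stars (V T : finType) (F : V -> {set T}) :
  \sum_x #|[set v | x \in F v]| = \sum_v #|F v|.
Proof.
under eq_bigr => x _ do rewrite -sum1dep_card big_mkcond /=.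
rewrite exchange_big; apply: eq_bigr => v _.
by rewrite -big_mkcond sum1_card.
Qed.

(** The [n] stars are independent and together count every vertex [k] times. *)
Lemma leq_alpha_induced_kneser (n k : nat) (S : {set kneser n k}) :
  0 < k -> k * #|induced S| <= n * alpha (induced S).
Proof.
move=> k0; pose F (v : induced S) : {set 'I_n} := val (val v).
have cF v : #|F v| = k by apply/eqP; apply: valP (val v).
have -> : k * #|induced S| = \sum_v #|F v|.
  by rewrite mulnC -sum_nat_const; apply: eq_bigr => v _; rewrite cF.
have -> : n * alpha (induced S) = \sum_(x < n) alpha (induced S).
  by rewrite sum_nat_const card_ord.
rewrite -sum_card_stars; apply: leq_sum => x _; rewrite /alpha.
apply: (@leq_bigmax_cond _ _ (fun A : {set induced S} => #|A|)).
apply/forall_inP=> A; rewrite inE => xA; apply/forall_inP=> B.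
rewrite inE => xB; apply/negP => /andP[_]; rewrite -setI_eq0 => /eqP/setP/(_ x).
by rewrite !inE -/(F A) -/(F B) xA xB.
Qed.

Theorem mainTheorem5 (R : realType) :
  (~ exists C c : R, [/\ (0 < C)%R, (0 < c)%R &
       forall G : sgraph, (0 < #|G|)%N -> has_good_induced C c G]) /\
  (forall C c : R, (0 < C)%R -> (0 < c)%R ->
     exists k0 : nat, forall k : nat, (k0 <= k)%N ->
       ~ has_good_induced C c (kneser (3 * k) k)).
Proof.
have kneser_bad (C c : R) : (0 < C)%R -> (0 < c)%R ->
     exists k0 : nat, forall k : nat, (k0 <= k)%N ->
       ~ has_good_induced C c (kneser (3 * k) k).
  move=> C0 c0.
  (* Once [chi] of the Kneser graph exceeds [3 * C / c], the subgraph must have [chi] above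
     [3 * C]. *)
  have [k0 chi_big] := chi_kneser_third_unbounded (Num.truncn (3 * C / c)).
  exists k0.+1 => k ltk0k [S [S0 chiS alphaS]].
  have k_gt0 := leq_ltn_trans (leq0n _) ltk0k.
  have := chi_big k (ltnW ltk0k); rewrite truncn_lt_nat; last first.
    by rewrite divr_ge0 ?mulr_ge0 // ltW.
  rewrite ltr_pdivrMr // [ltRHS]mulrC => /lt_le_trans/(_ chiS).
  apply/negP; rewrite -leNgt.
  have chi0 : (0 < (chi (induced S))%:R :> R)%R by rewrite ltr0n chi_gt0.
  rewrite mulrA ler_pdivlMr // in alphaS.
  have : #|induced S| <= 3 * alpha (induced S).
    have := leq_alpha_induced_kneser _ _ S k_gt0.
    by rewrite -mulnA mulnCA leq_pmul2l.
  rewrite -(ler_nat R) natrM => leS.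
  (* After scaling by the order of the subgraph: [|S| * chi <= 3 * alpha * chi <= 3 * C * |S|]. *)
  rewrite -(ler_pM2l (_ : 0 < #|induced S|%:R)%R) ?ltr0n //.
  apply: le_trans (ler_wpM2r (ltW chi0) leS) _.
  by rewrite -mulrA [leRHS]mulrCA ler_pM2l // [leRHS]mulrC.
split=> // -[C [c [C0 c0 good]]]; have [k0 bad] := kneser_bad C c C0 c0.
(* The graph is nonempty, since ['C(3 * k0, k0)] is positive. *)
apply: bad (leqnn k0) (good _ _).
by rewrite card_sig (eq_card (_ : _ =i [set A : {set 'I__} | #|A| == k0])) => [|A];
  rewrite ?card_draws ?card_ord ?bin_gt0 ?leq_pmull // inE.
Qed.
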